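(* Let $(X,r)$ be a ray-based generalized continuum; that is, $X$ is a generalized continuum and $r:[0,\infty)\to X$ is a proper embedding. Then there exists a proper map $\rho:X\to[0,\infty)$ such that $\rho\circ r=\mathrm{id}:[0,\infty)\to[0,\infty)$. In particular, $r\circ\rho:X\to\operatorname{Im}r$ is a proper retraction of $X$ onto the image of $r$.
   Context: A generalized continuum is a Hausdorff space that is connected, locally connected, $\sigma$-compact (a union of countably many compact subspaces), and locally compact. Maps are continuous; a map is proper if the preimage of each compact subspace is compact. *)

(* Defs.v *)
From HB Require Import structures.
From mathcomp Require Import all_boot all_order all_algebra.
From mathcomp Require Import all_classical all_reals all_analysis.

Set Implicit Arguments.
Unset Strict Implicit.
Unset Printing Implicit Defensive.

Import Order.TTheory GRing.Theory Num.Theory.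
Import numFieldNormedType.Exports.

Local Open Scope classical_set_scope.
Local Open Scope ring_scope.

Definition locally_connected (X : topologicalType) : Prop :=
  forall (x : X) (U : set X), nbhs x U ->
    exists V : set X, [/\ open V, connected V, V x & V `<=` U].

Definition sigma_compact (X : topologicalType) : Prop :=
  exists K : nat -> set X, (forall n, compact (K n)) /\
    \bigcup_n K n = [set: X].

Definition generalized_continuum (X : topologicalType) : Prop :=
  [/\ hausdorff_space X, connected [set: X], locally_connected X,
      sigma_compact X & locally_compact [set: X]].

Definition proper_map (X Y : topologicalType) (f : X -> Y) : Prop :=
  continuous f /\ forall K : set Y, compact K -> compact (f @^-1` K).

Definition homeomorphism (X Y : topologicalType) (f : X -> Y) : Prop :=
  continuous f /\
  exists g : Y -> X, [/\ continuous g, cancel f g & cancel g f].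

(* A set used as a type is the library's [set_type], with the subspace
   topology. *)
Definition corestrict (X Y : topologicalType) (f : X -> Y) (x : X) : range f :=
  SigSub (mem_set (imageT f x)).

Definition embedding (X Y : topologicalType) (f : X -> Y) : Prop :=
  homeomorphism (corestrict f).

Definition proper_embedding (X Y : topologicalType) (f : X -> Y) : Prop :=
  proper_map f /\ embedding f.

Definition half_line (R : realType) : set R := `[0, +oo[%classic.
Arguments half_line R : clear implicits.

Definition ray_based_generalized_continuum (R : realType)
    (X : topologicalType) (r : half_line R -> X) : Prop :=
  generalized_continuum X /\ proper_embedding r.

Definition proper_retraction (X : topologicalType) (A : set X) (q : X -> A)
    : Prop :=
  proper_map q /\ forall a : A, q (set_val a) = a.

(* Main.v *)
Require Import Defs.
From mathcomp Require Import all_boot all_order all_algebra.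
From mathcomp Require Import all_classical all_reals all_analysis.
From mathcomp Require Import lra.

Set Implicit Arguments.
Unset Strict Implicit.
Unset Printing Implicit Defensive.

Import Order.TTheory GRing.Theory Num.Theory.
Import numFieldNormedType.Exports.

Local Open Scope classical_set_scope.
Local Open Scope ring_scope.

(* Exhaust X by compact sets K_n with K_n in the interior of K_(n+1) and
   r([0, n]) in K_(n+1). Summing Urysohn functions that vanish on K_n and equal
   1 off the interior of K_(n+1) gives a proper h with h (r t) <= t + 2; summing
   them with large weights gives a continuous k with k (r t) >= t. Tietze's
   theorem on the one-point compactification gives a bounded continuous g with
   g (r t) = 1 / (1 + t). Then max (h - 2) (1 / max g (1 / (1 + k)) - 1) takes
   the value t at r t: the lower bound h - 2 makes it proper, and the bound
   1 / (1 + k) keeps the denominator positive off the ray. *)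

(** * Locally compact Hausdorff spaces: Urysohn functions, exhaustions, proper maps *)

Lemma locally_compact_nbhs (X : topologicalType) (x : X) :
  locally_compact [set: X] -> exists2 U, nbhs x U & compact U.
Proof. by move=> /(_ x I)[U]; rewrite withinET => Ux [cU _]; exists U. Qed.

(* A single application of the near-covering form of compactness, to the filter
   on sets of X generated by the supersets of the compact sets. *)
Lemma compact_sub_interior (X : topologicalType) (K : set X) :
  locally_compact [set: X] -> compact K -> exists2 C, compact C & K `<=` C°.
Proof.
move=> lcX /compact_near_coveringP cK.
pose F : set_system (set X) := filter_from compact (fun C => [set L | C `<=` L]).
have FF : Filter F.
  apply: filter_from_filter; first by exists set0; exact: compact0.
  move=> A B cA cB; exists (A `|` B); first exact: compactU.
  by move=> L ABL; split; apply: subset_trans ABL => ?; [left|right].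
have [x Kx|C cC] := cK _ F (fun L x => L° x) FF; last first.
  by move=> CK; exists C => //; exact: CK.
have [U Ux cU] := locally_compact_nbhs x lcX.
exists (U°, [set L | U `<=` L]); last first.
  by move=> [y L] /= [Uy UL]; apply: interiorS Uy.
by split; [exact: nbhs_interior|exists U].
Qed.

Lemma one_point_compactification_normal (X : topologicalType) :
  locally_compact [set: X] -> hausdorff_space X ->
  normal_space (one_point_compactification X).
Proof.
move=> lcX hX; apply: compact_normal.
  exact: one_point_compactification_hausdorff.
exact: one_point_compactification_compact.
Qed.

(** Urysohn's lemma is applied in the one-point compactification, which is normal: there [K] is
    closed because compact, and [U] stays open. *)
Lemma compact_urysohn (R : realType) (X : topologicalType) (K U : set X) :
  locally_compact [set: X] -> hausdorff_space X ->
  compact K -> open U -> K `<=` U ->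
  exists u : X -> R, [/\ continuous u, forall x, 0 <= u x <= 1,
    forall x, K x -> u x = 0 & forall x, ~ U x -> u x = 1].
Proof.
move=> lcX hX cK oU KU; pose Y := one_point_compactification X.
have nY : normal_space Y by exact: one_point_compactification_normal.
have someC := @one_point_compactification_some_continuous X.
have cA : closed (Some @` K : set Y).
  apply: compact_closed; first exact: one_point_compactification_hausdorff.
  by apply: continuous_compact => //; exact: continuous_subspaceT.
have cB : closed (~` (Some @` U : set Y)).
  by apply: open_closedC; exact: one_point_compactification_open_some.
have [||u [cu u0 u1 u01]] := @urysohn_ext_itv Y R nY _ _ 0 1 cA cB.
- by rewrite -subset0 => _ [[x Kx <-] []]; exists x => //; exact: KU.
- exact: ltr01.
exists (u \o Some); split => [x|x|x Kx|x nUx].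
- exact: (continuous_comp (someC x) (cu _)).
- by have := u01 (u (Some x)); rewrite /= in_itv /=; apply; exists (Some x).
- by apply: u0; exists (Some x) => //; exists x.
- by apply: u1; exists (Some x) => // -[y Uy [yx]]; apply: nUx; rewrite -yx.
Qed.

(** [h] is the series of the [w i * u i], with [u i] the Urysohn function of [K i] in the interior
    of [K i.+1]. On [K n] the terms from index [n] on vanish; off [K n] the first [n] functions all
    equal 1. *)
Lemma exhaustion_sum (R : realType) (X : topologicalType) (K : nat -> set X)
    (w : nat -> R) :
  locally_compact [set: X] -> hausdorff_space X ->
  (forall n, compact (K n)) -> (forall n, K n `<=` (K n.+1)°) ->
  (forall x, exists n, K n x) -> (forall n, 0 <= w n) ->
  exists h : X -> R, [/\ continuous h,
    forall x, 0 <= h x,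
    forall n x, K n x -> h x <= \sum_(i < n) w i &
    forall n x, ~ K n x -> \sum_(i < n) w i <= h x].
Proof.
move=> lcX hX cK KS Kcov w0.
have Kmono m n : (m <= n)%N -> K m `<=` K n.
  move=> /subnKC <-; elim: (n - m)%N => [|k IH]; first by rewrite addn0.
  by rewrite addnS => x /IH /KS; exact: interior_subset.
have /choice[u uP] n := @compact_urysohn R X _ _ lcX hX (cK n)
  (open_interior (K n.+1)) (KS n).
have /choice[N NP] := Kcov.
pose S n x := \sum_(i < n) w i * u i x.
(* The series is cut at a chosen index [N x] with [K (N x) x]; by [SE], later cuts give the same
   value. *)
pose h x := S (N x) x.
have SE m n x : K m x -> (m <= n)%N -> S n x = S m x.
  move=> Kx /subnKC <-; elim: (n - m)%N => [|k IH]; first by rewrite addn0.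
  rewrite addnS /S big_ord_recr /= -/(S _ _) IH.
  have [_ _ -> //] := uP (m + k)%N; first by rewrite mulr0 addr0.
  by apply: Kmono Kx; exact: leq_addr.
have hE n x : K n x -> h x = S n x.
  move=> Kx; case: (leqP n (N x)) => [le_n|/ltnW le_N]; first exact: SE.
  by rewrite /h -(SE _ _ _ (NP x) le_N).
have term0 i x : 0 <= w i * u i x.
  by have [_ /(_ x)/andP[? _] _ _] := uP i; rewrite mulr_ge0.
exists h; split => [x|x|n x Kx|n x nKx].
(* [K (N x)] may fail to be a neighbourhood of [x]; [K (N x).+1] is one, and [h] is a single finite
   sum on it. *)
- have cS : {for x, continuous (S (N x).+1)}.
    apply: continuous_big => [|i _ y]; first exact: add_continuous.
    apply: continuousM; first exact: cst_continuous.
    by have [+ _ _ _] := uP i; apply.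
  rewrite /continuous_at (hE (N x).+1 x); last first.
    by apply: interior_subset; apply: KS; exact: NP.
  apply: cvg_trans cS; apply: near_eq_cvg.
  have : nbhs x (K (N x).+1)° by apply: nbhs_interior; apply: KS; exact: NP.
  by apply: filterS => y /interior_subset Ky; rewrite (hE _ _ Ky).
- by apply: sumr_ge0.
- rewrite (hE _ _ Kx); apply: ler_sum => i _.
  by have [_ /(_ x)/andP[_ ?] _ _] := uP i; rewrite ler_piMr.
- have le_nN : (n <= N x)%N.
    by rewrite leqNgt; apply/negP => /ltnW/Kmono/(_ x (NP x)).
  have -> : \sum_(i < n) w i = S n x.
    apply: eq_bigr => i _; have [_ _ _ ->] := uP i; first by rewrite mulr1.
    by move=> /interior_subset/(Kmono _ _ (ltn_ord i)).
  rewrite /h -(subnKC le_nN); elim: (N x - n)%N => [|k IH].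
    by rewrite addn0.
  by rewrite addnS {2}/S big_ord_recr /= -/(S _ _) (le_trans IH)// lerDl.
Qed.

Lemma proper_map_closed_range (X Y : topologicalType) (f : X -> Y) :
  locally_compact [set: Y] -> hausdorff_space Y -> proper_map f ->
  closed (range f).
Proof.
move=> lcY hY [cf pf] y cly.
have [U Uy cU] := locally_compact_nbhs y lcY.
have clfU : closed (f @` (f @^-1` U)).
  apply: compact_closed => //; apply: continuous_compact; last exact: pf.
  exact: continuous_subspaceT.
suff /clfU[x _ <-] : closure (f @` (f @^-1` U)) y by exists x.
move=> V Vy; have [_ [[x _ <-] [Vx Ux]]] := cly _ (filterI Vy Uy).
by exists (f x); split => //; exists x.
Qed.

(** * The half-line and its compact subsets *)

Lemma half_line_ge0 (R : realType) (t : half_line R) : 0 <= set_val t.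
Proof. by have := set_valP t; rewrite /half_line /= in_itv /= andbT. Qed.

Lemma half_line_max0 (R : realType) (t : R) : half_line R (Num.max 0 t).
Proof. by rewrite /half_line /= in_itv /= le_max lexx. Qed.

Definition to_half_line (R : realType) (t : R) : half_line R :=
  SigSub (mem_set (half_line_max0 t)).

Lemma to_half_lineK (R : realType) (t : half_line R) :
  to_half_line (set_val t) = t.
Proof. by apply: val_inj; apply: max_r; exact: half_line_ge0. Qed.

Lemma set_val_to_half_line (R : realType) (t : R) :
  0 <= t -> set_val (to_half_line t) = t.
Proof. exact: max_r. Qed.

Lemma continuous_to_half_line (R : realType) (X : topologicalType)
    (f : X -> R) :
  continuous f -> continuous (fun x => to_half_line (f x)).
Proof.
move=> cf; apply: continuous_comp_initial => x.
by apply: continuous_max; [exact: cst_continuous|exact: cf].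
Qed.

Lemma compact_ray_segment (R : realType) (X : topologicalType)
    (r : half_line R -> X) (a : R) :
  continuous r -> compact [set r t | t in [set t | set_val t <= a]].
Proof.
move=> cr.
have -> : [set r t | t in [set t | set_val t <= a]] =
    (fun t => r (to_half_line t)) @` `[0, a].
  apply/seteqP; split => [_ [t ta <-]|_ [t + <-]] /=.
    exists (set_val t); last by rewrite to_half_lineK.
    by rewrite /= in_itv /= half_line_ge0.
  move=> /=; rewrite in_itv /= => /andP[t0 ta]; exists (to_half_line t) => //=.
  by rewrite set_val_to_half_line.
apply: continuous_compact; last exact: segment_compact.
apply: continuous_subspaceT => t.
apply: (@continuous_comp _ _ _ (@to_half_line R) r); last exact: cr.
by apply: (@continuous_to_half_line _ _ id) => ?; exact: cvg_id.
Qed.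

Lemma compact_half_line_ubound (R : realType) (K : set (half_line R)) :
  compact K -> exists2 m, 0 <= m & forall t, K t -> set_val t <= m.
Proof.
move=> cK; have /compact_bounded[M [_ MP]] : compact (set_val @` K : set R).
  apply: continuous_compact => //; apply: continuous_subspaceT.
  exact: initial_continuous.
(* Boundedness holds for every number strictly above [M]; this one is also nonnegative. *)
exists (`|M| + 1) => [|t Kt]; first by rewrite addr_ge0.
have ltM : M < `|M| + 1 by rewrite (le_lt_trans (ler_norm M))// ltrDl.
by rewrite (le_trans (ler_norm _))// (MP _ ltM)//; exists t.
Qed.

(** * The parameter of a ray, and an exhaustion adapted to it *)

Lemma embedding_inverse (R : realType) (X : topologicalType)
    (r : half_line R -> X) : embedding r ->
  exists s : X -> R, {within range r, continuous s} /\
    forall t, s (r t) = set_val t.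
Proof.
move=> [_ [g [cg rK _]]].
(* Off the range the value is the default [0]. *)
exists (valL_ 0 (set_val \o g)); split.
  apply/subspace_valL_continuousP' => x.
  apply: continuous_comp; first exact: cg.
  exact: initial_continuous.
move=> t; rewrite -{2}(rK t).
exact: (congr1 (@^~ (corestrict r t)) (valLK 0 (set_val \o g))).
Qed.

(* The reciprocal of [1 + r^-1] vanishes at infinity, so that it extends
   continuously to the one-point compactification, where Tietze's theorem
   applies. *)
Lemma ray_reciprocal_extension (R : realType) (X : topologicalType)
    (r : half_line R -> X) :
  locally_compact [set: X] -> hausdorff_space X -> proper_embedding r ->
  exists g : X -> R, [/\ continuous g, forall x, `|g x| <= 1 &
    forall t, g (r t) = (1 + set_val t)^-1].
Proof.
move=> lcX hX [pr er]; pose Y := one_point_compactification X.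
have nY : normal_space Y by exact: one_point_compactification_normal.
have clr := proper_map_closed_range lcX hX pr.
have [s [cs sr]] := embedding_inverse er.
pose A : set Y := (Some @` range r) `|` [set None].
pose f (y : Y) : R := if y is Some x then (1 + s x)^-1 else 0.
have clA : closed A.
  rewrite -openC (_ : ~` A = Some @` (~` range r)).
    by apply: one_point_compactification_open_some; exact: closed_openC.
  apply/seteqP; split => [[x|]|_ [x nx <-]] /=.
  - by move=> nA; exists x => // rx; apply: nA; left; exists x.
  - by case; right.
  - by move=> [[z rz [zx]]|//]; apply: nx; rewrite -zx.
have s0 x : range r x -> 0 <= s x by move=> [t _ <-]; rewrite sr half_line_ge0.
have cf : {within A, continuous f}.
  apply/subspace_continuousP => -[x|] /= Ax.
    have rx : range r x by case: Ax => [[z rz [<-]]|].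
    have : f (Some x') @[x' --> within (range r) (nbhs x)] --> f (Some x).
      rewrite /f /=; apply: cvgV; first by rewrite gt_eqF// ltr_pwDl ?s0.
      apply: cvgD; first exact: cvg_cst.
      by move/subspace_continuousP : cs; apply.
    move=> + U Uf => /(_ U Uf); rewrite /nbhs /= /within /=.
    rewrite !nbhs_simpl /=; apply: filterS => x' /= + Ax'.
    by apply; case: Ax' => [[z rz [<-]]|].
  (* At infinity: off the compact arc of parameters [t <= e^-1], the value [(1 + t)^-1] is less than
     [e]. *)
  apply/cvgrPdist_lt => e e0 /=; rewrite /within /=.
  pose C := [set r t | t in [set t | set_val t <= e^-1]].
  have cC : compact C by apply: compact_ray_segment; case: pr.
  exists C; first by split => //; exact: compact_closed.
  move=> [x|] /=; last by rewrite subrr normr0.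
  move=> [[z nCz [zx]]|//] [[_ [t _ <-] [tx]]|//].
  rewrite sub0r normrN -tx /from_subspace /f /= sr.
  have := half_line_ge0 t => t0.
  rewrite gtr0_norm ?invr_gt0 ?ltr_pwDl// -[ltRHS]invrK.
  rewrite ltf_pV2 ?posrE ?ltr_pwDl// ?invr_gt0//.
  by rewrite leNgt; apply/negP => /ltW te; apply: nCz; rewrite zx -tx; exists t.
have f1 y : A y -> `|f y| <= 1.
  move=> [[x rx <-]|->] /=; last by rewrite normr0.
  rewrite ger0_norm ?invr_ge0 ?addr_ge0 ?s0//.
  by rewrite invf_le1 ?lerDl ?s0// ltr_pwDl ?s0.
have [g [gf cg g1]] := continuous_bounded_extension nY clA ltr01 cf f1.
exists (g \o Some); split => [x|x|t] //=.
  by apply: (continuous_comp _ (cg _)) => U.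
by rewrite -gf /f ?sr// inE; left; exists (r t).
Qed.

Lemma ray_exhaustion (R : realType) (X : topologicalType)
    (r : half_line R -> X) :
  locally_compact [set: X] -> sigma_compact X -> continuous r ->
  exists K : nat -> set X, [/\ forall n, compact (K n),
    forall n, K n `<=` (K n.+1)°, forall x, exists n, K n x &
    forall n t, set_val t <= n%:R -> K n.+1 (r t)].
Proof.
move=> lcX [C [cC Ccov]] cr.
(* The dummy [set0] for noncompact [A] makes [L] total, so that the recursion defining [K] can use
   it. *)
have /choice[L LP] (A : set X) :
    exists B, compact A -> compact B /\ A `<=` B°.
  have [cA|ncA] := pselect (compact A); last by exists set0.
  by have [B cB AB] := compact_sub_interior lcX cA; exists B => _.
pose seg n := [set r t | t in [set t | set_val t <= n%:R]].
pose K := fix K n := if n is n.+1 then L (K n `|` C n `|` seg n) else set0.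
have cU n : compact (K n) -> compact (K n `|` C n `|` seg n).
  by move=> cKn; do 2?apply: compactU => //; exact: compact_ray_segment.
have cK n : compact (K n).
  by elim: n => [|n /cU/LP[]//]; exact: compact0.
have KS n : K n `|` C n `|` seg n `<=` (K n.+1)° by have /LP[] := cU n (cK n).
exists K; split => [//|n x Kx|x|n t tn].
- by apply: KS; left; left.
- have [n _ Cx] : (\bigcup_n C n) x by rewrite Ccov.
  by exists n.+1; apply: interior_subset; apply: KS; left; right.
- by apply: interior_subset; apply: KS; right; exists t.
Qed.

Theorem theorem5p8 (R : realType) (X : topologicalType)
    (r : half_line R -> X) (hXr : ray_based_generalized_continuum r) :
  exists rho : X -> half_line R,
    [/\ proper_map rho,
        rho \o r = id &
        proper_retraction (corestrict r \o rho)].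
Proof.
case: hXr => -[hX _ _ scX lcX] emb; have [[cr pr] [ccr [q [cq crK qK]]]] := emb.
have [K [cK KS Kcov rK]] := ray_exhaustion lcX scX cr.
have [h [ch h0 hK hnK]] := @exhaustion_sum R X K (fun=> 1) lcX hX cK KS Kcov
  (fun=> ler01).
(* If [n] is the integer part of [t], then [t <= n + 1], so [r t] lies in [K n.+2] and
   [h (r t) <= n + 2 <= t + 2]. *)
have hr t : h (r t) <= set_val t + 2.
  have /= := hK (Num.truncn (set_val t)).+2 (r t).
  rewrite sumr_const card_ord => /(_ _)/le_trans; apply.
    by apply: rK; rewrite ltW// truncnS_gt.
  by rewrite -[_.+2]addn2 natrD lerD2r truncn_le// half_line_ge0.
have /choice[m mP] n : exists m, 0 <= m /\ forall t, K n (r t) -> set_val t <= m.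
  by have [m m0 mP] := compact_half_line_ubound (pr _ (cK n)); exists m.
(* If [r t] lies in [K n.+2] but not in [K n.+1], then [k (r t)] is at least the sum of the first
   [n.+1] weights, whose last is [m n.+2 >= t]. The constants [m 0] and [m 1] in [k'] cover [K 0]
   and [K 1]. *)
have [k [ck k0 _ knK]] := @exhaustion_sum R X K (fun i => m i.+2) lcX hX cK KS
  Kcov (fun i => (mP i.+2).1).
pose k' x := m 0%N + m 1%N + k x.
have k'r t : set_val t <= k' (r t).
  have [n] := Kcov (r t); have [m0 _] := mP 0%N; have [m1 _] := mP 1%N.
  have kt := k0 (r t).
  elim: n => [|n IH] Kn; first by have := (mP 0%N).2 _ Kn; rewrite /k'; lra.
  have [/IH//|nKn] := pselect (K n (r t)).
  have := (mP _).2 _ Kn; case: n nKn {IH Kn} => [_|n /knK].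
    by rewrite /k'; lra.
  rewrite big_ord_recr /= /k'.
  have : 0 <= \sum_(i < n) m i.+2 by apply: sumr_ge0 => i _; case: (mP i.+2).
  lra.
have [g [cg g1 gr]] := ray_reciprocal_extension lcX hX emb.
pose d x := (1 + k' x)^-1.
have k'0 x : 0 <= k' x.
  by rewrite /k' !addr_ge0//; [case: (mP 0%N)|case: (mP 1%N)].
have k'1 x : 0 < 1 + k' x by rewrite ltr_pwDl.
pose rho0 x := Num.max (h x - 2) ((Num.max (g x) (d x))^-1 - 1).
have gd_gt0 x : 0 < Num.max (g x) (d x) by rewrite lt_max invr_gt0 k'1 orbT.
have cd : continuous d.
  move=> x; apply: cvgV; first by rewrite gt_eqF.
  by apply: cvgD; [exact: cvg_cst|]; apply: cvgD; [exact: cvg_cst|exact: ck].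
have cgd : continuous (fun x => (Num.max (g x) (d x))^-1).
  move=> x; apply: cvgV; first by rewrite gt_eqF.
  by apply: (@continuous_max R X g d); [exact: cg|exact: cd].
have crho0 : continuous rho0.
  move=> x; apply: (@continuous_max R X (fun x => h x - 2)
    (fun x => (Num.max (g x) (d x))^-1 - 1)).
    by apply: cvgB; [exact: ch|exact: cvg_cst].
  by apply: cvgB; [exact: cgd|exact: cvg_cst].
(* Both [g] and [d] are at most 1, so the reciprocal of their maximum is at least 1. *)
have rho0_ge0 x : 0 <= rho0 x.
  rewrite /rho0 le_max; apply/orP; right.
  rewrite subr_ge0 invf_ge1// ge_max (le_trans (ler_norm _))//=.
  by rewrite invf_le1 ?lerDl.
(* As [k' (r t) >= t], the inner maximum is [g (r t)]; by [hr] the outer one is then [t]. *)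
have rho0r t : rho0 (r t) = set_val t.
  have := half_line_ge0 t => t0.
  rewrite /rho0 gr (_ : Num.max _ (d _) = (1 + set_val t)^-1).
    by rewrite invrK addrAC subrr add0r max_r// lerBlDr.
  by rewrite max_l// lef_pV2 ?posrE ?k'1 ?ltr_pwDl// lerD2l.
pose rho x := to_half_line (rho0 x).
have rhor t : rho (r t) = t by rewrite /rho rho0r to_half_lineK.
have crho : continuous rho by exact: continuous_to_half_line.
have prho A : compact A -> compact (rho @^-1` A).
  move=> cA; have [M _ MP] := compact_half_line_ubound cA.
  have clA : closed (set_val @` A : set R).
    apply: compact_closed; first exact: Rhausdorff.
    apply: continuous_compact => //; apply: continuous_subspaceT.
    exact: initial_continuous.
  have -> : rho @^-1` A = rho0 @^-1` (set_val @` A).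
    apply/seteqP; split => x /= => [Ax|[t At tx]].
      by exists (rho x) => //; rewrite set_val_to_half_line.
    by rewrite /rho -tx to_half_lineK.
  (* Off [K n], [h >= n > M + 2], so [rho0 > M]: the preimage is a closed subset of [K n]. *)
  pose n := (Num.truncn (M + 2)).+1.
  apply: (@subclosed_compact _ _ (K n)) => //.
    by apply: preimage_closed => // x _; exact: crho0.
  move=> x [t /MP tM tx]; apply: contrapT => /hnK.
  rewrite sumr_const card_ord -/n => nh; have := truncnS_gt (M + 2).
  have : h x - 2 <= rho0 x by rewrite /rho0 le_max lexx.
  rewrite -/n -tx; lra.
exists rho; split; first by split.
  by apply/funext => t; exact: rhor.
split; first split.
- by move=> x; apply: continuous_comp; [exact: crho|exact: ccr].
- move=> A cA; rewrite comp_preimage; apply: prho.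
  (* [q] is the continuous inverse of [corestrict r], so this preimage is a continuous image of
     [A]. *)
  rewrite (_ : _ @^-1` A = q @` A).
    by apply: continuous_compact => //; exact: continuous_subspaceT.
  apply/seteqP; split => [t /= At|_ [a Aa <-] /=]; last by rewrite qK.
  by exists (corestrict r t).
- move=> a; rewrite -{1}(qK a) /= -{2}(qK a); congr (corestrict r _).
  exact: rhor.
Qed.
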